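(* Let $\lambda\in\mathbb{R}$ and let $k\ge 1$ be an integer. For every integer $n\ge 0$, $$\frac{\lambda^{n}}{(n+1)^{k}}=\frac{1}{n+1}\sum_{m=1}^{n+1}m\,\widehat{D}_{m-1,\lambda}^{(k)}S_{2}(n+1,m)=\frac{1}{n+1}\sum_{m=0}^{n}(m+1)\,\widehat{D}_{m,\lambda}^{(k)}S_{2}(n+1,m+1).$$
   Context: The multiple degenerate Daehee numbers $\widehat{D}_{n,\lambda}^{(k)}$ ($n\ge 0$) are defined by the $k$-fold integral over the unit cube $$\frac{\log(1+t)}{t}\int_{0}^{1}\cdots\int_{0}^{1}(1+t)^{\lambda x_{1}x_{2}\cdots x_{k}}\,dx_{1}dx_{2}\cdots dx_{k}=\sum_{n=0}^{\infty}\widehat{D}_{n,\lambda}^{(k)}\frac{t^{n}}{n!},$$ as a power series in $t$ (for $|t|$ small). The Stirling numbers of the second kind $S_2(n,l)$ are defined by $x^n=\sum_{l=0}^n S_2(n,l)(x)_l$ for $n\ge 0$, where $(x)_0=1$ and $(x)_n=x(x-1)\cdots(x-n+1)$ for $n\ge 1$. Convention: $0^0=1$. *)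

(* Defs.v *)
From Stdlib Require Import Reals Factorial List ClassicalEpsilon.
From Coquelicot Require Import Coquelicot.
Open Scope R_scope.

(* Iterated integral over [0,1]^k; the argument of f is the list [x1; ...; xk]. *)
Fixpoint cube_int (k : nat) (f : list R -> R) : R :=
  match k with
  | O => f nil
  | S k' => RInt (fun x => cube_int k' (fun xs => f (x :: xs))) 0 1
  end.

Definition prod_list (xs : list R) : R := fold_right Rmult 1 xs.

Definition daehee_gf (lambda : R) (k : nat) (t : R) : R :=
  ln (1 + t) / t * cube_int k (fun xs => Rpower (1 + t) (lambda * prod_list xs)).

(* The expansion is required on a punctured neighbourhood of 0: daehee_gf has a
   removable singularity at t = 0, where Rocq's division would give the value 0
   instead of the limit 1. This still determines D uniquely. *)
Definition is_daehee (lambda : R) (k : nat) (D : nat -> R) : Prop :=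
  locally' 0 (fun t =>
    is_pseries (fun n => D n / INR (fact n)) t (daehee_gf lambda k t)).

Definition daehee (lambda : R) (k : nat) : nat -> R :=
  epsilon (inhabits (fun _ => 0)) (is_daehee lambda k).

(* (x)_n = x (x - 1) ... (x - n + 1) *)
Fixpoint falling (x : R) (n : nat) : R :=
  match n with
  | O => 1
  | S n' => falling x n' * (x - INR n')
  end.

Definition is_stirling2 (n : nat) (s : nat -> R) : Prop :=
  forall x : R, x ^ n = sum_n (fun l => s l * falling x l) n.

(* S2 n l is determined by is_stirling2 for l <= n only. *)
Definition S2 (n : nat) : nat -> R :=
  epsilon (inhabits (fun _ => 0)) (is_stirling2 n).

(* Main.v *)
Require Import Defs.
From Stdlib Require Import Reals Factorial List Lra Lia ClassicalEpsilon.
From Coquelicot Require Import Coquelicot.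
Open Scope R_scope.

(** Write L(p) for the integral of p'(lambda x1 ... xk) over the unit cube, a linear
    functional on polynomials p. Differentiating the binomial series
    (1 + t)^y = sum_m (y)_m t^m / m! in y gives
    ln(1 + t) (1 + t)^y = sum_m (y)_m' t^m / m!, and integrating this at
    y = lambda x1 ... xk gives
    t * daehee_gf lambda k t = sum_m L((y)_m) t^m / m!.
    Hence m D_(m-1) = L((y)_m) for the Daehee numbers D ([daehee_weighted]).
    The theorem is then L applied to the identity
    y^(n+1) = sum_m S2(n+1,m) (y)_m that defines the Stirling numbers: its left-hand
    side has L(y^(n+1)) = (n+1) lambda^n / (n+1)^k.

    The analytic content is the passage of the integral through the series
    ([cube_mean_binomial_series]). For |y| <= |lambda| = B - 2 both (y)_m and (y)_m'
    are at most m! B^m in absolute value, so for |t| < 1/(2B) the N-th remainder of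
    the differentiated series is at most 2^-N uniformly in y, and averaging over the
    cube preserves this bound. The two series are themselves identified through the
    linear differential equations (1 + t) f' = y f and (1 + t) h' = y h + f of their
    sums ([falling_gf], [dfalling_gf]).

    As the Daehee and Stirling numbers are chosen by [epsilon], it must also be shown
    that they exist, which the series above and the usual recurrence provide, and
    that the Daehee numbers are unique ([pseries_punctured_unique]). For the Stirling
    numbers the defining identity alone suffices. *)

(** * Averages over the unit cube *)

(** The carrier of an equation between reals may appear as a projection of a canonical
    structure, while [ring] and [field] need to see [R] itself. *)
Ltac real_eq := match goal with |- ?l = ?r => change (@eq R l r) end.

(** The dilation factor a is a parameter because the average over k + 1 variables is
    the average over x in [0,1] of the average over k variables at a * x; this makes
    induction on k possible. *)
Definition cube_mean (k : nat) (g : R -> R) (a : R) : R :=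
  cube_int k (fun xs => g (a * prod_list xs)).

Lemma cube_int_ext (k : nat) (f g : list R -> R) :
  (forall xs, f xs = g xs) -> cube_int k f = cube_int k g.
Proof.
  revert f g; induction k as [|k IH]; intros f g H; simpl.
  - apply H.
  - apply RInt_ext; intros x _. apply IH; intros xs; apply H.
Qed.

Lemma cube_mean_0 (g : R -> R) (a : R) : cube_mean 0 g a = g a.
Proof. unfold cube_mean; simpl. now rewrite Rmult_1_r. Qed.

Lemma cube_mean_S (k : nat) (g : R -> R) (a : R) :
  cube_mean (S k) g a = RInt (fun x => cube_mean k g (a * x)) 0 1.
Proof.
  unfold cube_mean; simpl. apply RInt_ext; intros x _.
  apply cube_int_ext; intros xs; f_equal; simpl; ring.
Qed.

Lemma unit_dilation_bound (a x : R) : 0 <= x <= 1 -> Rabs (a * x) <= Rabs a.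
Proof.
  intros Hx. rewrite Rabs_mult, (Rabs_pos_eq x) by lra.
  pose proof (Rabs_pos a); nra.
Qed.

Lemma ex_RInt_dilation (h : R -> R) (a : R) :
  (forall y, continuous h y) -> ex_RInt (fun x => h (a * x)) 0 1.
Proof.
  intros Hh. apply (ex_RInt_continuous (V := R_CompleteNormedModule)); intros x _.
  apply (continuous_comp (fun x => a * x) h); [|apply Hh].
  apply (continuous_scal_r (K := R_AbsRing) (V := R_NormedModule) a (fun x => x)), continuous_id.
Qed.

(** A continuous h is uniformly continuous on [-|a| - 1, |a| + 1], which contains all
    the points a x and b x with x in [0,1] and |b - a| < 1. *)
Lemma continuous_RInt_dilation (h : R -> R) (a : R) :
  (forall y, continuous h y) ->
  continuous (fun a => RInt (fun x => h (a * x)) 0 1) a.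
Proof.
  intros Hh. apply continuity_pt_filterlim, continuity_pt_locally; intros eps.
  set (C := Rabs a + 1).
  destruct (@Heine_cor2 h (- C) C) with (eps := mkposreal (eps / 2) (is_pos_div_2 eps))
    as [delta Hdelta].
  { intros y _. apply continuity_pt_filterlim, Hh. }
  assert (Hpos : 0 < Rmin 1 delta) by (apply Rmin_pos; [lra|apply cond_pos]).
  exists (mkposreal _ Hpos); intros b Hb.
  change (Rabs (b - a) < Rmin 1 delta) in Hb.
  pose proof (Rmin_l 1 delta); pose proof (Rmin_r 1 delta).
  rewrite <- (RInt_minus (V := R_CompleteNormedModule) (fun x => h (b * x)) (fun x => h (a * x)));
    try now apply ex_RInt_dilation.
  assert (Hle : Rabs (RInt (fun x => minus (h (b * x)) (h (a * x))) 0 1)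
                <= (1 - 0) * (eps / 2)).
  { apply abs_RInt_le_const; [lra| |].
    - apply (ex_RInt_minus (V := R_CompleteNormedModule)); now apply ex_RInt_dilation.
    - intros x Hx. change (Rabs (h (b * x) - h (a * x)) <= eps / 2).
      assert (Hax := unit_dilation_bound a x Hx).
      assert (Hbx := unit_dilation_bound b x Hx).
      assert (Hba := unit_dilation_bound (b - a) x Hx).
      assert (Rabs b <= C).
      { unfold C. replace b with (a + (b - a)) by ring.
        eapply Rle_trans; [apply Rabs_triang|lra]. }
      assert (Rabs a <= C) by (unfold C; lra).
      apply Rlt_le, Hdelta.
      + apply Rabs_le_between. lra.
      + apply Rabs_le_between. lra.
      + replace (b * x - a * x) with ((b - a) * x) by ring. lra. }
  pose proof (cond_pos eps). eapply Rle_lt_trans; [exact Hle|simpl; lra].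
Qed.

Lemma continuous_cube_mean (k : nat) (g : R -> R) :
  (forall y, continuous g y) -> forall a, continuous (cube_mean k g) a.
Proof.
  intros Hg; induction k as [|k IH]; intros a.
  - apply continuous_ext with g; [|apply Hg].
    intros y; symmetry; apply cube_mean_0.
  - apply continuous_ext with (fun a => RInt (fun x => cube_mean k g (a * x)) 0 1).
    + intros y; symmetry; apply cube_mean_S.
    + now apply continuous_RInt_dilation.
Qed.

Lemma cube_mean_plus (k : nat) (g h : R -> R) (a : R) :
  (forall y, continuous g y) -> (forall y, continuous h y) ->
  cube_mean k (fun y => g y + h y) a = cube_mean k g a + cube_mean k h a.
Proof.
  intros Hg Hh; revert a; induction k as [|k IH]; intros a.
  - now rewrite !cube_mean_0.
  - rewrite !cube_mean_S.
    etransitivity; [apply RInt_ext; intros x _; apply IH|].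
    apply (RInt_plus (V := R_CompleteNormedModule)
             (fun x => cube_mean k g (a * x)) (fun x => cube_mean k h (a * x)));
      now apply ex_RInt_dilation, continuous_cube_mean.
Qed.

Lemma cube_mean_scal (k : nat) (c : R) (g : R -> R) (a : R) :
  (forall y, continuous g y) ->
  cube_mean k (fun y => c * g y) a = c * cube_mean k g a.
Proof.
  intros Hg; revert a; induction k as [|k IH]; intros a.
  - now rewrite !cube_mean_0.
  - rewrite !cube_mean_S.
    etransitivity; [apply RInt_ext; intros x _; apply IH|].
    apply (RInt_scal (V := R_CompleteNormedModule) (fun x => cube_mean k g (a * x))).
    now apply ex_RInt_dilation, continuous_cube_mean.
Qed.

Lemma cube_mean_ext (k : nat) (g h : R -> R) (a : R) :
  (forall y, g y = h y) -> cube_mean k g a = cube_mean k h a.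
Proof. intros H. apply cube_int_ext; intros xs; apply H. Qed.

Lemma continuous_sum_scal (g : nat -> R -> R) (c : nat -> R) (N : nat) (y : R) :
  (forall m y, continuous (g m) y) ->
  continuous (fun y => sum_n (fun m => c m * g m y) N) y.
Proof.
  intros Hg; induction N as [|N IH].
  - apply continuous_ext with (fun y => c 0%nat * g 0%nat y).
    { intros z; now rewrite sum_O. }
    apply (continuous_scal_r (K := R_AbsRing) (V := R_NormedModule) (c 0%nat) (g 0%nat)), Hg.
  - apply continuous_ext with
      (fun y => plus (sum_n (fun m => c m * g m y) N) (c (S N) * g (S N) y)).
    { intros z; now rewrite sum_Sn. }
    apply (continuous_plus (V := R_NormedModule)); [exact IH|].
    apply (continuous_scal_r (K := R_AbsRing) (V := R_NormedModule) (c (S N)) (g (S N))), Hg.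
Qed.

Lemma cube_mean_sum (k : nat) (g : nat -> R -> R) (c : nat -> R) (N : nat) (a : R) :
  (forall m y, continuous (g m) y) ->
  cube_mean k (fun y => sum_n (fun m => c m * g m y) N) a
  = sum_n (fun m => c m * cube_mean k (g m) a) N.
Proof.
  intros Hg; induction N as [|N IH].
  - rewrite sum_O, <- cube_mean_scal by apply Hg.
    apply cube_mean_ext; intros y; now rewrite sum_O.
  - rewrite sum_Sn, <- IH, <- cube_mean_scal by apply Hg.
    unfold plus; simpl. rewrite <- cube_mean_plus.
    + apply cube_mean_ext; intros y; now rewrite sum_Sn.
    + intros y; now apply continuous_sum_scal.
    + intros y; apply (continuous_scal_r (K := R_AbsRing) (V := R_NormedModule) (c (S N)) (g (S N))), Hg.
Qed.

(** Only the values at a x1 ... xk matter, and these points have absolute value at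
    most |a|. *)
Lemma cube_mean_bound (k : nat) (g : R -> R) (M a : R) :
  (forall y, continuous g y) -> (forall y, Rabs y <= Rabs a -> Rabs (g y) <= M) ->
  Rabs (cube_mean k g a) <= M.
Proof.
  intros Hg; revert a; induction k as [|k IH]; intros a HM.
  - rewrite cube_mean_0. apply HM, Rle_refl.
  - rewrite cube_mean_S. replace M with ((1 - 0) * M) by ring.
    apply abs_RInt_le_const; [lra| |].
    + now apply ex_RInt_dilation, continuous_cube_mean.
    + intros x Hx. apply IH; intros y Hy. apply HM.
      eapply Rle_trans; [exact Hy|now apply unit_dilation_bound].
Qed.

Lemma cube_mean_pow (k n : nat) (a : R) :
  cube_mean k (fun y => y ^ n) a = a ^ n / INR (n + 1) ^ k.
Proof.
  assert (Hn : INR (n + 1) <> 0) by (apply not_0_INR; lia).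
  revert a; induction k as [|k IH]; intros a.
  - rewrite cube_mean_0. simpl. field.
  - rewrite cube_mean_S.
    assert (Hk : INR (n + 1) ^ k <> 0) by now apply pow_nonzero.
    apply is_RInt_unique.
    replace (a ^ n / INR (n + 1) ^ S k)
      with (minus (a ^ n / INR (n + 1) ^ S k * 1 ^ (n + 1))
              (a ^ n / INR (n + 1) ^ S k * 0 ^ (n + 1))).
    2:{ rewrite pow1, pow_i by lia. unfold minus, plus, opp; simpl. field. now split. }
    apply is_RInt_ext with (fun x => a ^ n / INR (n + 1) ^ k * x ^ n).
    { intros x _. rewrite IH, Rpow_mult_distr.
      real_eq. field. exact Hk. }
    apply (is_RInt_derive (V := R_CompleteNormedModule)
             (fun x => a ^ n / INR (n + 1) ^ S k * x ^ (n + 1))).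
    + intros x _. auto_derive; [trivial|].
      replace (Init.Nat.pred (n + 1)) with n by lia. simpl. field. now split.
    + intros x _. apply continuity_pt_filterlim. reg.
Qed.

(** * Falling factorials and their derivatives *)

Fixpoint dfalling (x : R) (n : nat) : R :=
  match n with
  | O => 0
  | S n' => dfalling x n' * (x - INR n') + falling x n'
  end.

Lemma is_derive_falling (m : nat) (x : R) :
  is_derive (fun y => falling y m) x (dfalling x m).
Proof.
  induction m as [|m IH]; simpl.
  - apply (is_derive_const (V := R_NormedModule)).
  - replace (dfalling x m * (x - INR m) + falling x m)
      with (dfalling x m * (x - INR m) + falling x m * 1) by ring.
    apply (is_derive_mult (K := R_AbsRing) (fun y => falling y m) (fun y => y - INR m)).
    + exact IH.
    + auto_derive; [trivial|ring].
    + exact Rmult_comm.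
Qed.

Lemma continuous_falling (m : nat) (x : R) : continuous (fun y => falling y m) x.
Proof.
  apply (ex_derive_continuous (V := R_NormedModule)).
  eexists; apply is_derive_falling.
Qed.

Lemma continuous_dfalling (m : nat) (x : R) : continuous (fun y => dfalling y m) x.
Proof.
  induction m as [|m IH]; simpl.
  - apply continuous_const.
  - apply (continuous_plus (V := R_NormedModule)); [|apply continuous_falling].
    apply (continuous_mult (K := R_AbsRing)); [exact IH|].
    apply (continuous_minus (V := R_NormedModule)); [apply continuous_id|apply continuous_const].
Qed.

(** Both recurrences multiply by a factor x - m, and |x - m| + 1 <= (m + 1) B; the
    summand 1 absorbs the extra term of the product rule. *)
Lemma falling_dfalling_bound (B x : R) (m : nat) :
  Rabs x + 2 <= B ->
  Rabs (falling x m) <= INR (fact m) * B ^ m /\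
  Rabs (dfalling x m) <= INR (fact m) * B ^ m.
Proof.
  intros HB. pose proof (Rabs_pos x) as Hx.
  induction m as [|m [IH1 IH2]]; simpl falling; simpl dfalling.
  - simpl. rewrite Rabs_R1, Rabs_R0. lra.
  - assert (Hstep : Rabs (x - INR m) + 1 <= INR (S m) * B).
    { pose proof (pos_INR m). rewrite S_INR.
      assert (Rabs (x - INR m) <= Rabs x + INR m).
      { unfold Rminus. eapply Rle_trans; [apply Rabs_triang|].
        rewrite Rabs_Ropp, (Rabs_pos_eq (INR m)); lra. }
      nra. }
    set (M := INR (fact m) * B ^ m) in *.
    assert (HM : 0 <= M) by (pose proof (Rabs_pos (falling x m)); lra).
    replace (INR (fact (S m)) * B ^ S m) with (M * (INR (S m) * B)).
    2:{ unfold M. rewrite fact_simpl, mult_INR. simpl pow. ring. }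
    pose proof (Rabs_pos (x - INR m)).
    pose proof (Rabs_pos (falling x m)). pose proof (Rabs_pos (dfalling x m)).
    split.
    + rewrite Rabs_mult. nra.
    + eapply Rle_trans; [apply Rabs_triang|]. rewrite Rabs_mult. nra.
Qed.

(** * The binomial series and its derivative in the exponent *)

(** Variation of constants for (1 + t) y' = a y + s (1 + t)^a, where u' = s / (1 + t):
    the function
    y (1 + t)^(-a) - u has derivative zero and vanishes at 0. *)
Lemma linear_ode_solution (a r : R) (y dy s u : R -> R) :
  0 < r <= 1 ->
  (forall t, Rabs t < r -> is_derive y t (dy t)) ->
  (forall t, Rabs t < r -> is_derive u t (s t / (1 + t))) ->
  (forall t, Rabs t < r -> (1 + t) * dy t = a * y t + s t * exp (a * ln (1 + t))) ->
  y 0 = u 0 ->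
  forall t, Rabs t < r -> y t = u t * exp (a * ln (1 + t)).
Proof.
  intros Hr Hy Hu Hode H0 t Ht.
  set (w := fun t => y t * exp (- (a * ln (1 + t))) - u t).
  assert (Hexp : forall z, exp (- z) * exp z = 1).
  { intros z. rewrite <- exp_plus, Rplus_opp_l. apply exp_0. }
  assert (Hw : forall z, Rabs z < r -> is_derive w z 0).
  { intros z Hz. assert (Hz1 : 0 < 1 + z) by (apply Rabs_lt_between in Hz; lra).
    unfold w. auto_derive.
    - repeat split; [eexists; now apply Hy|exact Hz1|eexists; now apply Hu].
    - replace (Derive (fun x => y x) z) with (dy z)
        by (symmetry; apply is_derive_unique, Hy, Hz).
      replace (Derive (fun x => u x) z) with (s z / (1 + z))
        by (symmetry; apply is_derive_unique, Hu, Hz).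
      specialize (Hode z Hz). specialize (Hexp (a * ln (1 + z))).
      set (E := exp (- (a * ln (1 + z)))) in *. set (F := exp (a * ln (1 + z))) in *.
      replace (dy z) with ((a * y z + s z * F) / (1 + z))
        by (rewrite <- Hode; field; lra).
      transitivity (s z / (1 + z) * (E * F - 1)); [field; lra|rewrite Hexp; ring]. }
  assert (Hin : forall z, Rmin 0 t <= z <= Rmax 0 t -> Rabs z < r).
  { intros z Hz. apply Rabs_lt_between in Ht. apply Rabs_lt_between.
    unfold Rmin, Rmax in Hz. destruct (Rle_dec 0 t); lra. }
  destruct (MVT_gen w 0 t (fun _ => 0)) as [c [_ Hc]].
  - intros z Hz. apply Hw, Hin; lra.
  - intros z Hz. apply continuity_pt_filterlim.
    apply (ex_derive_continuous (V := R_NormedModule)). exists 0. now apply Hw, Hin.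
  - assert (Hw0 : w 0 = 0).
    { unfold w. rewrite Rplus_0_r, ln_1, Rmult_0_r, Ropp_0, exp_0, H0. ring. }
    rewrite Hw0 in Hc. unfold w in Hc.
    specialize (Hexp (a * ln (1 + t))).
    set (E := exp (- (a * ln (1 + t)))) in *. set (F := exp (a * ln (1 + t))) in *.
    assert (HyE : y t * E = u t) by lra.
    rewrite <- HyE, Rmult_assoc, Hexp. ring.
Qed.

Lemma pseries_inside (c : nat -> R) (r : R) :
  0 <= r -> (forall m, Rabs (c m * r ^ m) <= 1) ->
  forall t, Rabs t < r -> Rbar_lt (Rabs t) (CV_radius c).
Proof.
  intros Hr Hc t Ht. apply Rbar_lt_le_trans with r; [exact Ht|].
  apply (proj1 (CV_radius_bounded c)). now exists 1.
Qed.

(** For c m = (x)_m / m! the coefficient on the right is x * c m, by the recurrence of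
    the falling factorials; this turns the recurrence into a differential equation. *)
Lemma PSeries_ode_operator (c : nat -> R) (t : R) :
  Rbar_lt (Rabs t) (CV_radius c) ->
  (1 + t) * PSeries (PS_derive c) t
  = PSeries (fun m => INR (S m) * c (S m) + INR m * c m) t.
Proof.
  intros Ht. rewrite Rmult_plus_distr_r, Rmult_1_l, <- PSeries_incr_1.
  rewrite <- PSeries_plus.
  - apply PSeries_ext; intros [|m]; unfold PS_plus, PS_incr_1, PS_derive, plus, zero; simpl; ring.
  - now apply ex_pseries_derive.
  - now apply ex_pseries_incr_1, ex_pseries_derive.
Qed.

Lemma coefficient_bound (B q : R) (m : nat) :
  0 < B -> Rabs q <= INR (fact m) * B ^ m ->
  forall t, Rabs t <= / (2 * B) -> Rabs (q / INR (fact m) * t ^ m) <= (1 / 2) ^ m.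
Proof.
  intros HB Hq t Ht. pose proof (INR_fact_lt_0 m) as Hf.
  rewrite Rabs_mult, <- RPow_abs.
  unfold Rdiv at 1. rewrite Rabs_mult, (Rabs_pos_eq (/ _)) by (apply Rlt_le, Rinv_0_lt_compat, Hf).
  assert (H1 : Rabs q * / INR (fact m) <= B ^ m).
  { apply Rmult_le_reg_r with (INR (fact m)); [exact Hf|].
    rewrite Rmult_assoc, Rinv_l by lra. lra. }
  replace ((1 / 2) ^ m) with (B ^ m * / (2 * B) ^ m).
  2:{ rewrite <- pow_inv. rewrite <- Rpow_mult_distr. f_equal. field. lra. }
  apply Rmult_le_compat.
  - apply Rmult_le_pos; [apply Rabs_pos|apply Rlt_le, Rinv_0_lt_compat, Hf].
  - apply pow_le, Rabs_pos.
  - exact H1.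
  - rewrite <- pow_inv. apply pow_incr. split; [apply Rabs_pos|exact Ht].
Qed.

Lemma falling_gf_inside (B x t : R) :
  Rabs x + 2 <= B -> Rabs t < / (2 * B) ->
  Rbar_lt (Rabs t) (CV_radius (fun m => falling x m / INR (fact m))) /\
  Rbar_lt (Rabs t) (CV_radius (fun m => dfalling x m / INR (fact m))).
Proof.
  intros HB Ht. pose proof (Rabs_pos x).
  assert (Hr : 0 < / (2 * B)) by (apply Rinv_0_lt_compat; lra).
  assert (Hpow : forall m, (1 / 2) ^ m <= 1).
  { intros m. rewrite <- (pow1 m) at 2. apply pow_incr; lra. }
  split; apply pseries_inside with (/ (2 * B)); try assumption; try lra; intros m;
    (eapply Rle_trans; [|apply (Hpow m)]);
    (apply coefficient_bound with B; [lra| |rewrite Rabs_pos_eq; lra]);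
    now apply falling_dfalling_bound.
Qed.

Lemma radius_le_1 (B : R) : 2 <= B -> 0 < / (2 * B) <= 1.
Proof.
  intros HB. split; [apply Rinv_0_lt_compat; lra|].
  rewrite <- Rinv_1. apply Rinv_le_contravar; lra.
Qed.

(** The binomial series, as the solution of (1 + t) f' = x f with f(0) = 1. *)
Lemma falling_gf (B x t : R) :
  Rabs x + 2 <= B -> Rabs t < / (2 * B) ->
  PSeries (fun m => falling x m / INR (fact m)) t = exp (x * ln (1 + t)).
Proof.
  intros HB Ht. pose proof (Rabs_pos x).
  set (c := fun m => falling x m / INR (fact m)).
  assert (Hin : forall z, Rabs z < / (2 * B) -> Rbar_lt (Rabs z) (CV_radius c))
    by (intros z Hz; now apply falling_gf_inside with B).
  transitivity (1 * exp (x * ln (1 + t))); [|ring].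
  apply (linear_ode_solution x (/ (2 * B)) (PSeries c) (PSeries (PS_derive c))
           (fun _ => 0) (fun _ => 1)); try assumption.
  - apply radius_le_1; lra.
  - intros z Hz. now apply is_derive_PSeries, Hin.
  - intros z Hz. unfold Rdiv; rewrite Rmult_0_l. apply (is_derive_const (V := R_NormedModule)).
  - intros z Hz. rewrite PSeries_ode_operator by now apply Hin.
    rewrite Rmult_0_l, Rplus_0_r, <- PSeries_scal.
    apply PSeries_ext; intros m. unfold PS_scal, scal, c; simpl; unfold mult; simpl.
    change (match m with O => 1 | S _ => INR m + 1 end) with (INR (S m)).
    change (fact m + m * fact m)%nat with (fact (S m)).
    rewrite fact_simpl, mult_INR.
    field. split; [apply INR_fact_neq_0|now apply not_0_INR].
  - rewrite PSeries_0. unfold c; simpl. field.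
Qed.

(** The derivative in x of the binomial series. Differentiating its coefficients turns
    the equation (1 + t) f' = x f into (1 + t) h' = x h + f, whose solution with
    h(0) = 0 is ln(1 + t) (1 + t)^x. *)
Lemma dfalling_gf (B x t : R) :
  Rabs x + 2 <= B -> Rabs t < / (2 * B) ->
  is_pseries (fun m => dfalling x m / INR (fact m)) t
    (ln (1 + t) * exp (x * ln (1 + t))).
Proof.
  intros HB Ht. pose proof (Rabs_pos x).
  set (c := fun m => dfalling x m / INR (fact m)).
  assert (Hin : forall z, Rabs z < / (2 * B) -> Rbar_lt (Rabs z) (CV_radius c))
    by (intros z Hz; now apply falling_gf_inside with B).
  replace (ln (1 + t) * exp (x * ln (1 + t))) with (PSeries c t).
  { apply PSeries_correct, CV_disk_correct, CV_disk_inside, Hin, Ht. }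
  assert (Hr := radius_le_1 B ltac:(lra)).
  apply (linear_ode_solution x (/ (2 * B)) (PSeries c) (PSeries (PS_derive c))
           (fun _ => 1) (fun t => ln (1 + t))); try assumption.
  - intros z Hz. now apply is_derive_PSeries, Hin.
  - intros z Hz. apply Rabs_lt_between in Hz.
    auto_derive; [lra|]. field. lra.
  - intros z Hz. rewrite PSeries_ode_operator by now apply Hin.
    rewrite Rmult_1_l, <- (falling_gf B x z HB Hz), <- PSeries_scal, <- PSeries_plus.
    + apply PSeries_ext; intros m. unfold PS_plus, PS_scal, plus, scal, c; simpl; unfold mult; simpl.
      change (match m with O => 1 | S _ => INR m + 1 end) with (INR (S m)).
      change (fact m + m * fact m)%nat with (fact (S m)).
      rewrite fact_simpl, mult_INR.
      field. split; [apply INR_fact_neq_0|now apply not_0_INR].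
    + apply ex_pseries_scal; [apply Rmult_comm|].
      now apply CV_disk_correct, CV_disk_inside, Hin.
    + apply CV_disk_correct, CV_disk_inside. now apply (falling_gf_inside B x z).
  - rewrite PSeries_0, Rplus_0_r, ln_1. unfold c; simpl. field.
Qed.

(** * Expansion of the generating function *)

Lemma geometric_remainder (u : nat -> R) (l : R) (N : nat) :
  is_series u l -> (forall m, Rabs (u m) <= (1 / 2) ^ m) ->
  Rabs (l - sum_n u N) <= (1 / 2) ^ N.
Proof.
  intros Hl Hu.
  assert (Hpos : forall m, 0 < (1 / 2) ^ m) by (intros m; apply pow_lt; lra).
  assert (Htail : forall M, Rabs (sum_n u (M + N) - sum_n u N) <= (1 / 2) ^ N - (1 / 2) ^ (M + N)).
  { induction M as [|M IH].
    - simpl. rewrite !Rminus_diag, Rabs_R0. lra.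
    - change (S M + N)%nat with (S (M + N)). rewrite sum_Sn. unfold plus; simpl.
      replace (sum_n u (M + N) + u (S (M + N)) - sum_n u N)
        with (sum_n u (M + N) - sum_n u N + u (S (M + N))) by ring.
      eapply Rle_trans; [apply Rabs_triang|].
      specialize (Hu (S (M + N))). simpl in Hu. lra. }
  assert (Hlim : is_lim_seq (fun M => Rabs (sum_n u (M + N) - sum_n u N)) (Rabs (l - sum_n u N))).
  { apply (is_lim_seq_abs _ (Finite (l - sum_n u N))).
    apply is_lim_seq_minus'; [|apply is_lim_seq_const].
    apply (is_lim_seq_incr_n (sum_n u)), Hl. }
  apply (is_lim_seq_le _ (fun _ => (1 / 2) ^ N) _ (Finite ((1 / 2) ^ N)) ) in Hlim.
  - exact Hlim.
  - intros M. specialize (Htail M). specialize (Hpos (M + N)%nat). lra.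
  - apply is_lim_seq_const.
Qed.

(** Termwise integration: the remainder bound 2^-N for the series of [dfalling_gf] is
    uniform over |y| <= |a|, so it survives averaging over the cube. *)
Lemma cube_mean_binomial_series (k : nat) (a t : R) :
  Rabs t < / (2 * (Rabs a + 2)) ->
  is_pseries (fun m => cube_mean k (fun y => dfalling y m) a / INR (fact m)) t
    (cube_mean k (fun y => ln (1 + t) * exp (y * ln (1 + t))) a).
Proof.
  intros Ht. set (B := Rabs a + 2) in Ht. pose proof (Rabs_pos a) as Ha.
  set (g := fun y => ln (1 + t) * exp (y * ln (1 + t))).
  assert (Hg : forall y, continuous g y).
  { intros y. apply (ex_derive_continuous (V := R_NormedModule)).
    unfold g. auto_derive. trivial. }
  assert (Hrem : forall N,
    Rabs (cube_mean k g a
          - sum_n (fun m => t ^ m / INR (fact m) * cube_mean k (fun y => dfalling y m) a) N)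
    <= (1 / 2) ^ N).
  { intros N.
    rewrite <- (cube_mean_sum k (fun m y => dfalling y m) (fun m => t ^ m / INR (fact m)))
      by (intros; apply continuous_dfalling).
    set (p := fun y => sum_n (fun m => t ^ m / INR (fact m) * dfalling y m) N).
    assert (Hp : forall y, continuous p y).
    { intros y. apply (continuous_sum_scal (fun m y => dfalling y m) (fun m => t ^ m / INR (fact m))).
      intros; apply continuous_dfalling. }
    (* the difference as an average, so that a single pointwise bound applies *)
    replace (cube_mean k g a - cube_mean k p a)
      with (cube_mean k (fun y => g y + -1 * p y) a).
    2:{ rewrite (cube_mean_plus k g (fun y => -1 * p y)), cube_mean_scal; try assumption.
        - ring.
        - intros y. now apply (continuous_scal_r (K := R_AbsRing) (V := R_NormedModule) (-1) p). }
    apply cube_mean_bound.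
    - intros y. apply (continuous_plus (V := R_NormedModule)); [apply Hg|].
      now apply (continuous_scal_r (K := R_AbsRing) (V := R_NormedModule) (-1) p).
    - intros y Hy. replace (g y + -1 * p y) with (g y - p y) by ring.
      assert (HB : Rabs y + 2 <= B) by (unfold B; lra).
      pose proof (Rabs_pos y).
      apply geometric_remainder.
      + generalize (dfalling_gf B y t HB Ht). apply is_series_ext; intros m.
        rewrite pow_n_pow. unfold scal; simpl; unfold mult; simpl.
        field. apply INR_fact_neq_0.
      + intros m. replace (t ^ m / INR (fact m) * dfalling y m)
          with (dfalling y m / INR (fact m) * t ^ m) by (field; apply INR_fact_neq_0).
        apply coefficient_bound with B; [lra| |lra].
        now apply falling_dfalling_bound. }
  unfold is_pseries, is_series.
  change (is_lim_seq (sum_n (fun m => scal (pow_n t m) (cube_mean k (fun y => dfalling y m) a / INR (fact m))))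
            (cube_mean k g a)).
  apply (is_lim_seq_ext
    (sum_n (fun m => t ^ m / INR (fact m) * cube_mean k (fun y => dfalling y m) a))).
  { intros N. apply sum_n_ext; intros m. simpl scal. rewrite (pow_n_pow t m).
    unfold scal; simpl; unfold mult; simpl. field. apply INR_fact_neq_0. }
  apply (proj1 (is_lim_seq_spec _ _)). intros eps.
  destruct (pow_lt_1_zero (1 / 2)) with (y := pos eps) as [N HN].
  - rewrite Rabs_pos_eq; lra.
  - apply cond_pos.
  - exists N; intros n Hn. rewrite Rabs_minus_sym.
    eapply Rle_lt_trans; [apply Hrem|].
    eapply Rle_lt_trans; [apply Rle_abs|now apply HN].
Qed.

Lemma cube_mean_dfalling_0 (k : nat) (a : R) : cube_mean k (fun y => dfalling y 0) a = 0.
Proof.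
  apply Rabs_eq_0, Rle_antisym; [|apply Rabs_pos].
  apply cube_mean_bound; intros y.
  - apply continuous_dfalling.
  - intros _. simpl. rewrite Rabs_R0. apply Rle_refl.
Qed.

(** The constant term of the averaged series vanishes, so dividing by t only shifts its
    coefficients, and its coefficient of t^(n+1) / (n+1)! is (n+1) times the n-th Daehee
    number. *)
Definition daehee_value (lambda : R) (k n : nat) : R :=
  cube_mean k (fun y => dfalling y (n + 1)) lambda / INR (n + 1).

Lemma is_daehee_value (lambda : R) (k : nat) :
  is_daehee lambda k (daehee_value lambda k).
Proof.
  pose proof (Rabs_pos lambda).
  assert (Hr := radius_le_1 (Rabs lambda + 2) ltac:(lra)).
  exists (mkposreal _ (proj1 Hr)); intros t Ht Ht0.
  change (Rabs (t - 0) < / (2 * (Rabs lambda + 2))) in Ht. rewrite Rminus_0_r in Ht.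
  set (c := fun m => cube_mean k (fun y => dfalling y m) lambda / INR (fact m)).
  assert (Hc0 : c 0%nat = 0).
  { unfold c. rewrite cube_mean_dfalling_0. apply Rdiv_0_l. }
  assert (Hgf : daehee_gf lambda k t
    = / t * (cube_mean k (fun y => ln (1 + t) * exp (y * ln (1 + t))) lambda - c 0%nat)).
  { rewrite Hc0, (cube_mean_scal k (ln (1 + t)) (fun y => exp (y * ln (1 + t)))).
    - unfold daehee_gf, cube_mean, Rpower. field. exact Ht0.
    - intros y. apply (ex_derive_continuous (V := R_NormedModule)). auto_derive. trivial. }
  rewrite Hgf.
  apply (is_pseries_ext (PS_decr_1 c)).
  - intros m. unfold PS_decr_1, c, daehee_value.
    replace (m + 1)%nat with (S m) by lia.
    rewrite fact_simpl, mult_INR. real_eq. field.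
    split; (apply INR_fact_neq_0 || now apply not_0_INR).
  - apply (is_pseries_decr_1 (K := R_AbsRing) (V := R_NormedModule)).
    + now apply Rinv_l.
    + now apply cube_mean_binomial_series.
Qed.

(** Multiplying both series by t makes them agree at 0 as well, which reduces the claim
    to uniqueness on a full neighbourhood. *)
Lemma pseries_punctured_unique (f : R -> R) (c d : nat -> R) :
  locally' 0 (fun t => is_pseries c t (f t)) ->
  locally' 0 (fun t => is_pseries d t (f t)) -> forall n, c n = d n.
Proof.
  intros Hc Hd n.
  assert (Hrad : forall e : nat -> R, locally' 0 (fun t => is_pseries e t (f t)) ->
            Rbar_lt 0 (CV_radius (PS_incr_1 e))).
  { intros e [eps He]. pose proof (cond_pos eps).
    assert (Ht : is_pseries e (eps / 2) (f (eps / 2))).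
    { apply He; [|lra]. change (Rabs (eps / 2 - 0) < eps). rewrite Rabs_pos_eq; lra. }
    rewrite CV_radius_incr_1.
    apply Rbar_lt_le_trans with (Rabs (eps / 2)); [simpl; rewrite Rabs_pos_eq; lra|].
    apply Rbar_not_lt_le; intros Hout. apply (CV_disk_outside _ _ Hout).
    apply ex_series_lim_0. exists (f (eps / 2)). revert Ht.
    apply is_series_ext; intros m. rewrite pow_n_pow. apply Rmult_comm. }
  apply (PSeries_ext_recip (PS_incr_1 c) (PS_incr_1 d) (S n)); try now apply Hrad.
  generalize (filter_and _ _ Hc Hd : locally' 0 _). unfold locally', within.
  apply (filter_imp (F := locally 0)); intros t Ht. rewrite !PSeries_incr_1.
  destruct (Req_dec t 0) as [->|Ht0]; [ring|].
  destruct (Ht Ht0) as [H1 H2].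
  now rewrite (is_pseries_unique _ _ _ H1), (is_pseries_unique _ _ _ H2).
Qed.

Lemma daehee_eq (lambda : R) (k n : nat) : daehee lambda k n = daehee_value lambda k n.
Proof.
  assert (Hd : is_daehee lambda k (daehee lambda k)).
  { unfold daehee. apply epsilon_spec. exists (daehee_value lambda k). apply is_daehee_value. }
  pose proof (pseries_punctured_unique _ _ _ Hd (is_daehee_value lambda k) n) as H.
  simpl in H. apply (Rmult_eq_reg_r (/ INR (fact n))); [exact H|].
  apply Rinv_neq_0_compat, INR_fact_neq_0.
Qed.

(** * Stirling numbers *)

Fixpoint stirling2 (n l : nat) : R :=
  match n, l with
  | O, O => 1
  | O, S _ => 0
  | S _, O => 0
  | S n', S l' => stirling2 n' l' + INR (S l') * stirling2 n' (S l')
  end.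

Lemma stirling2_above (n l : nat) : (n < l)%nat -> stirling2 n l = 0.
Proof.
  revert l; induction n as [|n IH]; intros [|l] Hl; try lia; simpl stirling2.
  - reflexivity.
  - rewrite !IH by lia. ring.
Qed.

(** From x (x)_l = (x)_(l+1) + l (x)_l. Stopping the sum at an arbitrary N leaves one
    boundary term, with which the identity goes through by induction on N; the
    boundary term vanishes at N = n. *)
Lemma stirling2_partial_sum (n N : nat) (x : R) :
  sum_n (fun l => stirling2 (S n) l * falling x l) (S N)
  = x * sum_n (fun l => stirling2 n l * falling x l) N
    + INR (S N) * stirling2 n (S N) * falling x (S N).
Proof.
  induction N as [|N IH].
  - rewrite sum_Sn, !sum_O. unfold plus; simpl. ring.
  - rewrite sum_Sn, IH, (sum_Sn _ N). unfold plus; cbn -[INR]. ring.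
Qed.

Lemma is_stirling2_stirling2 (n : nat) : is_stirling2 n (stirling2 n).
Proof.
  intros x. induction n as [|n IH].
  - rewrite sum_O. simpl. ring.
  - rewrite stirling2_partial_sum, <- IH, stirling2_above by lia. simpl pow. ring.
Qed.

Lemma S2_spec (n : nat) : is_stirling2 n (S2 n).
Proof. unfold S2. apply epsilon_spec. exists (stirling2 n). apply is_stirling2_stirling2. Qed.

(** The derivative of the identity that defines the Stirling numbers. *)
Lemma S2_dfalling (n : nat) (y : R) :
  sum_n (fun m => S2 (n + 1) m * dfalling y m) (n + 1) = INR (n + 1) * y ^ n.
Proof.
  assert (Hl : is_derive (fun z => sum_n (fun m => S2 (n + 1) m * falling z m) (n + 1)) y
                 (sum_n (fun m => S2 (n + 1) m * dfalling y m) (n + 1))).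
  { apply (is_derive_sum_n (K := R_AbsRing) (V := R_NormedModule)
             (fun m z => S2 (n + 1) m * falling z m)).
    intros m _. apply (is_derive_scal (fun z => falling z m)), is_derive_falling. }
  apply is_derive_unique in Hl. rewrite <- Hl.
  apply is_derive_unique, (is_derive_ext (fun z => z ^ (n + 1))).
  - intros z. apply S2_spec.
  - auto_derive; [trivial|]. replace (Init.Nat.pred (n + 1)) with n by lia. ring.
Qed.

(** * The identity *)

(** At m = 0 both sides are 0, whatever value the truncated m - 1 selects; the sum over
    m may therefore start at 0, where the Stirling expansion starts. *)
Lemma daehee_weighted (lambda : R) (k m : nat) :
  INR m * daehee lambda k (m - 1) = cube_mean k (fun y => dfalling y m) lambda.
Proof.
  destruct m as [|m].
  - rewrite cube_mean_dfalling_0. simpl. ring.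
  - rewrite daehee_eq. unfold daehee_value.
    replace (S m - 1 + 1)%nat with (S m) by lia. field. now apply not_0_INR.
Qed.

Theorem theorem2p7 (lambda : R) (k : nat) (hk : (1 <= k)%nat) (n : nat) :
  lambda ^ n / INR (n + 1) ^ k
    = 1 / INR (n + 1)
        * sum_n_m (fun m : nat => INR m * daehee lambda k (m - 1) * S2 (n + 1) m) 1 (n + 1)
  /\
  1 / INR (n + 1)
      * sum_n_m (fun m : nat => INR m * daehee lambda k (m - 1) * S2 (n + 1) m) 1 (n + 1)
    = 1 / INR (n + 1)
        * sum_n (fun m : nat => INR (m + 1) * daehee lambda k m * S2 (n + 1) (m + 1)) n.
Proof.
  assert (Hn : INR (n + 1) <> 0) by (apply not_0_INR; lia).
  set (f := fun m : nat => INR m * daehee lambda k (m - 1) * S2 (n + 1) m).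
  assert (Hf0 : sum_n_m f 1 (n + 1) = sum_n f (n + 1)).
  { unfold sum_n. rewrite (sum_Sn_m f 0) by lia.
    replace (f 0%nat) with (@zero R_AbelianMonoid).
    - symmetry; apply plus_zero_l.
    - unfold f, zero; simpl. real_eq. ring. }
  assert (Hsum : sum_n f (n + 1) = INR (n + 1) * (lambda ^ n / INR (n + 1) ^ k)).
  { rewrite <- cube_mean_pow, <- cube_mean_scal.
    2:{ intros y. apply continuity_pt_filterlim. reg. }
    rewrite <- (cube_mean_ext k _ _ lambda (S2_dfalling n)).
    rewrite (cube_mean_sum k (fun m y => dfalling y m)) by (intros; apply continuous_dfalling).
    apply sum_n_ext; intros m. unfold f. rewrite daehee_weighted. real_eq. ring. }
  split.
  - rewrite Hf0, Hsum. field. split; [now apply pow_nonzero|exact Hn].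
  - f_equal. replace (n + 1)%nat with (S n) at 1 by lia. unfold sum_n.
    rewrite <- sum_n_m_S. apply sum_n_m_ext; intros m. unfold f.
    replace (S m) with (m + 1)%nat by lia. now replace (m + 1 - 1)%nat with m by lia.
Qed.
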